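(* Let $d\in\mathbb{N}$ be fixed. Assume that $\zeta\in L^2([0,1]\times[0,1])$, that $\lambda_d>0$, and that there is a positive rate function $g(n)$ such that the following hold as $n\to\infty$: (P1) $\max_{1\le k<n}k^{-1/2}\big\|\sum_{i=1}^kY_i\big\|=O_P(g(n))$ and $\max_{1\le k<n}k^{-1/2}\big\|\sum_{i=1}^kY_{-i}\big\|=O_P(g(n))$; (B2) under $H_A$, $\big|\int\Delta(t)\hat v_r(t)\,dt\big|\xrightarrow{P}\xi$ for some $1\le r\le d$ and some constant $\xi>0$; (E1) under $H_A$, $\dfrac{n}{g^2(n)}\big(\hat\lambda_d/\hat\lambda_1\big)\xrightarrow{P}\infty$. Then under $H_A$, as $n\to\infty$, $$\hat k(\hat v,\hat\lambda,d)/n\xrightarrow{P}\theta.$$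
   Context: All function spaces are real; $\|\cdot\|$ is the norm of $L^2[0,1]$; $\int=\int_0^1$. Model. $\{Y_i\}_{i\in\mathbb{Z}}$ are $L^2[0,1]$-valued random elements on a probability space $(\Omega,\mathcal{A},P)$, product measurable in $(t,\omega)$. Standing assumption: $\{Y_i\}$ is centered and strictly stationary with $E\|Y_1\|^\nu<\infty$ for some $\nu>2$. The observations are $X_i(t)=\mu_i(t)+Y_i(t)$, $t\in[0,1]$, $i=1,\dots,n$, with deterministic $\mu_i\in L^2[0,1]$, and $\bar X_n=n^{-1}\sum_{i=1}^nX_i$. The alternative is $H_A:\ \mu_1=\dots=\mu_{\lfloor n\theta\rfloor}\ne\mu_{\lfloor n\theta\rfloor+1}=\dots=\mu_n$ for some constant $\theta\in(0,1)$; the change is $\Delta(t)=\mu_n(t)-\mu_1(t)$, a fixed function (not depending on $n$) with $\Delta\ne0$ in $L^2[0,1]$. Long run covariance. $\zeta(t,s)=\sum_{r\in\mathbb{Z}}E[Y_0(t)Y_r(s)]$ (convergence in $L^2([0,1]\times[0,1])$), and $(\mathcal{C}x)(t)=\int\zeta(t,s)x(s)\,ds$. When $\zeta\in L^2([0,1]\times[0,1])$, $\mathcal{C}$ is a symmetric positive Hilbert–Schmidt operator with eigenvalues $\lambda_1\ge\lambda_2\ge\dots\ge0$ and corresponding orthonormal eigenfunctions $v_1,v_2,\dots$. Estimates. $\{\hat v_i\}$ are random orthonormal functions in $L^2[0,1]$ and $\hat\lambda_1\ge\hat\lambda_2\ge\dots\ge0$ are random scalars (both depending on $n$), serving as generic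 estimates of $\{v_i\}$ and $\{\lambda_i\}$. Condition (E1) is understood to entail that $P(\hat\lambda_d>0)\to1$ (the ratio being read as $0$ if $\hat\lambda_1=0$). Change-point estimate. With $w(t)=(t(1-t))^{-1/2}$ and $\hat\eta_{k,r}=n^{-1/2}\int\sum_{i=1}^k[X_i(t)-\bar X_n(t)]\hat v_r(t)\,dt$, $$\hat k(\hat v,\hat\lambda,d)=\operatorname*{arg\,max}_{1\le k<n}\,w(k/n)\Big(\frac{\hat\eta_{k,1}^2}{\hat\lambda_1}+\dots+\frac{\hat\eta_{k,d}^2}{\hat\lambda_d}\Big)^{1/2},$$ meaning any (measurable choice of) maximizer. *)

(* Defs.v *)
From HB Require Import structures.
From mathcomp Require Import all_boot all_order all_algebra.
From mathcomp Require Import all_classical all_reals all_analysis.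

Set Implicit Arguments.
Unset Strict Implicit.
Unset Printing Implicit Defensive.
Import Order.TTheory GRing.Theory Num.Theory.
Import numFieldNormedType.Exports.

Local Open Scope classical_set_scope.
Local Open Scope ring_scope.

(* Functions on [0,1] are represented by measurable functions on R; their
   values outside [0,1] are irrelevant because every norm, integral and almost
   everywhere statement is taken with respect to Lebesgue measure restricted
   to [0,1]. Elements of L^2 are functions, identified only when equal a.e. *)
Section L2_unit_interval.
Context (R : realType).

Lemma leb_unit_lty : (@lebesgue_measure R `[0%R, 1%R]%classic < +oo)%E.
Proof. by rewrite lebesgue_measure_itv /= lte01 oppr0 adde0 ltry. Qed.

Definition leb01 : {finite_measure set (measurableTypeR R) -> \bar R} :=
  mfrestr (T := measurableTypeR R) (measurable_itv `[0, 1]) leb_unit_lty.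

Definition L2 : {pred (R -> R)} := Lfun leb01 2%:E.

Definition L2norm (f : R -> R) : R := fine ('N[leb01]_2%:E[EFin \o f])%E.

Definition inner (f g : R -> R) : R := \int[leb01]_t (f t * g t).

Definition L2square : {pred (measurableTypeR R * measurableTypeR R -> R)} :=
  Lfun (leb01 \x leb01)%E 2%:E.

Definition L2pow m : set ('I_m -> R -> R) :=
  [set x | forall j, x j \in L2].

Definition L2open m : set (set ('I_m -> R -> R)) :=
  [set U | U `<=` @L2pow m /\
    forall x, U x -> exists2 e : R, 0 < e &
      forall y, L2pow y -> (forall j, L2norm (y j \- x j) < e) -> U y].

Definition L2borel m : set (set ('I_m -> R -> R)) :=
  <<s @L2pow m, @L2open m >>.

End L2_unit_interval.

Section random_elements.
Context (R : realType) (disp : measure_display) (T : measurableType disp)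
        (P : probability T R).

Definition random_L2 (Z : T -> R -> R) :=
  (forall w, Z w \in @L2 R) /\
  (forall B, @L2borel R 1 B -> measurable [set w | B (fun=> Z w)]).

Definition product_measurable (Z : T -> R -> R) :=
  measurable_fun setT (fun z : T * measurableTypeR R => Z z.1 z.2).

Definition centered (Z : T -> R -> R) :=
  {ae @leb01 R, forall t, ('E_P[(fun w => Z w t)] = 0)%E}.

Definition strictly_stationary (Y : int -> T -> R -> R) :=
  forall (m : nat) (i : 'I_m -> int) (h : int) (B : set ('I_m -> R -> R)),
    L2borel B ->
    P [set w | B (fun j => Y (i j + h) w)] = P [set w | B (fun j => Y (i j) w)].

Definition cvg_in_probability (Z : nat -> T -> R) (l : R) :=
  forall e : R, 0 < e -> P [set w | e < `|Z n w - l|] @[n --> \oo] --> 0%E.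

Definition diverges_in_probability (Z : nat -> T -> R) :=
  forall M : R, P [set w | Z n w <= M] @[n --> \oo] --> 0%E.

Definition bigO_in_probability (Z : nat -> T -> R) (g : nat -> R) :=
  forall e : R, 0 < e -> exists M : R,
    \forall n \near \oo, (P [set w | (M * g n < `|Z n w|)%R] <= e%:E)%E.

Definition autocov (Y : int -> T -> R -> R) (r : int)
    (z : measurableTypeR R * measurableTypeR R) : R :=
  fine ('E_P[(fun w => (Y 0 w z.1 * Y r w z.2)%R)])%E.

(* The two-sided series is the limit of the sums over -N <= r <= N. *)
Definition long_run_cov (Y : int -> T -> R -> R)
    (zeta : measurableTypeR R * measurableTypeR R -> R) :=
  zeta \in @L2square R /\
  'N[(@leb01 R \x @leb01 R)]_2%:E[(fun z =>
     (autocov Y 0 z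
      + \sum_(1 <= r < N.+1) (autocov Y r%:Z z + autocov Y (- r%:Z) z)
      - zeta z)%R%:E)]%E @[N --> \oo] --> 0%E.

End random_elements.

Section spectrum.
Context (R : realType).

Definition cov_operator (zeta : measurableTypeR R * measurableTypeR R -> R)
    (x : R -> R) (t : R) : R :=
  \int[@leb01 R]_s (zeta (t, s) * x s).

(* Indices start at 1. The last clause says that no nonzero eigenvalue (counted
   with multiplicity) is missing from the list; the eigenvalue 0 need not be
   exhausted by the sequence. *)
Definition eigensystem (zeta : measurableTypeR R * measurableTypeR R -> R)
    (lam : nat -> R) (v : nat -> R -> R) :=
  [/\ forall i, (1 <= i)%N -> lam i.+1 <= lam i /\ 0 <= lam i,
      forall i, (1 <= i)%N -> v i \in @L2 R,
      forall i j, (1 <= i)%N -> (1 <= j)%N -> inner (v i) (v j) = (i == j)%:R,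
      forall i, (1 <= i)%N ->
        {ae @leb01 R, forall t, cov_operator zeta (v i) t = lam i * v i t}
    & forall (a : R) (x : R -> R), a != 0 -> x \in @L2 R ->
        {ae @leb01 R, forall t, cov_operator zeta x t = a * x t} ->
        (forall i, (1 <= i)%N -> inner (v i) x = 0) ->
        {ae @leb01 R, forall t, x t = 0}].

End spectrum.

Section change_point.
Context (R : realType) (disp : measure_display) (T : measurableType disp).

(* The means form a triangular array since the change occurs at floor(n theta).
   The condition is void for those n with an empty first segment. *)
Definition alternative (theta : R) (Delta : R -> R)
    (mu : nat -> nat -> R -> R) :=
  [/\ 0 < theta < 1,
      Delta \in @L2 R /\ ~ {ae @leb01 R, forall t, Delta t = 0},
      forall n i, (1 <= i <= n)%N -> mu n i \in @L2 R
    & forall n, let k0 := Num.truncn (n%:R * theta) in (1 <= k0)%N ->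
      [/\ forall i, (1 <= i <= k0)%N ->
            {ae @leb01 R, forall t, mu n i t = mu n 1%N t},
          forall i, (k0 < i <= n)%N ->
            {ae @leb01 R, forall t, mu n i t = mu n n t}
        & {ae @leb01 R, forall t, mu n n t - mu n 1%N t = Delta t}]].

Definition observation (mu : nat -> nat -> R -> R) (Y : int -> T -> R -> R)
    (n i : nat) (w : T) (t : R) : R :=
  mu n i t + Y i%:Z w t.

Definition sample_mean (X : nat -> nat -> T -> R -> R) (n : nat) (w : T)
    (t : R) : R :=
  n%:R^-1 * \sum_(1 <= i < n.+1) X n i w t.

Definition score (X : nat -> nat -> T -> R -> R) (vhat : nat -> nat -> T -> R -> R)
    (n k r : nat) (w : T) : R :=
  (Num.sqrt n%:R)^-1 *
  \int[@leb01 R]_t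
    ((\sum_(1 <= i < k.+1) (X n i w t - sample_mean X n w t)) * vhat n r w t).

Definition weight (t : R) : R := (Num.sqrt (t * (1 - t)))^-1.

Definition criterion (X : nat -> nat -> T -> R -> R)
    (vhat : nat -> nat -> T -> R -> R) (lamhat : nat -> nat -> T -> R)
    (d n k : nat) (w : T) : R :=
  weight (k%:R / n%:R) *
  Num.sqrt (\sum_(1 <= r < d.+1) score X vhat n k r w ^+ 2 / lamhat n r w).

(* The criterion is meaningful only where the d-th estimated eigenvalue is
   positive; elsewhere the choice of khat in {1, ..., n-1} is unconstrained. *)
Definition argmax_estimator (X : nat -> nat -> T -> R -> R)
    (vhat : nat -> nat -> T -> R -> R) (lamhat : nat -> nat -> T -> R)
    (d : nat) (khat : nat -> T -> nat) :=
  forall n, (2 <= n)%N ->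
  [/\ measurable_fun setT (khat n),
      forall w, (1 <= khat n w < n)%N
    & forall w, 0 < lamhat n d w -> forall k, (1 <= k < n)%N ->
        criterion X vhat lamhat d n k w
          <= criterion X vhat lamhat d n (khat n w) w].

Definition orthonormal_estimates (vhat : nat -> nat -> T -> R -> R) :=
  (forall n r, (1 <= r)%N -> random_L2 (vhat n r)) /\
  (forall n r s w, (1 <= r)%N -> (1 <= s)%N ->
     inner (vhat n r w) (vhat n s w) = (r == s)%:R).

Definition eigenvalue_estimates (lamhat : nat -> nat -> T -> R) :=
  forall n r, (1 <= r)%N ->
    measurable_fun setT (lamhat n r) /\
    forall w, lamhat n r.+1 w <= lamhat n r w /\ 0 <= lamhat n r w.

Definition max_partial_sum (Z : nat -> T -> R -> R) (n : nat) (w : T) : R :=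
  \big[Num.max/0]_(1 <= k < n)
    ((Num.sqrt k%:R)^-1 * L2norm (fun t => \sum_(1 <= i < k.+1) Z i w t)).

End change_point.

(* Main.v *)
Require Import Defs.
From HB Require Import structures.
From mathcomp Require Import all_boot all_order all_algebra.
From mathcomp Require Import all_classical all_reals all_analysis.
From mathcomp Require Import measurable_realfun zify ring lra.
Import Order.TTheory GRing.Theory Num.Theory.
Import numFieldNormedType.Exports.
Set Implicit Arguments.
Unset Strict Implicit.
Unset Printing Implicit Defensive.
Local Open Scope classical_set_scope.
Local Open Scope ring_scope.

(** Write [k0 = floor (n theta)], [tau = k0 / n], and let [v_r], [lam_r] stand
for the estimates. Projecting the weighted CUSUM process on [v_r] splits it
into noise minus signal,

      weight (k / n) * score k r = N k r - D k * inner Delta v_r,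

where [D k] is the weighted CUSUM of a step from [1] down to [0] after [k0]
([weighted_score]).

Noise. Up to the normalization, [N k r] is a combination of the sum of the
first [k] errors, divided by [sqrt k], and of the last [n - k] errors, divided
by [sqrt (n - k)], with coefficients at most [1]; since the [v_r] are unit
vectors, [|N k r|] is at most twice a common bound [b] for the two maxima
([cusum_noise_le]). The weight function cancels exactly the normalization of
the maximal inequalities. The maximum over the last errors is that of the
reversed process; stationarity gives it the law of the maximum over negative
indices ([max_partial_sum_shift]), so both maxima are [O_P (g n)].

Signal. [D k0 ^ 2 = n tau (1 - tau)], and [D] has a sharp peak at [k0]:
[D k ^ 2 <= (1 - |k / n - tau|) D k0 ^ 2] ([signal_peak], [signal_decay]).

Comparison. If the criterion at [k] is at least the criterion at [k0], then the
loss of signal must be made up by noise. Young's inequality, applied in each of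
the [d] coordinates, absorbs the cross terms into half of that loss
([argmax_signal_le]) and yields ([argmax_localization])

  |k / n - tau| ^ 2 * n tau (1 - tau) * (inner Delta v_r) ^ 2 / lam_1
     <= 64 d b ^ 2 / lam_d.

With [b = M g n], with [|inner Delta v_r| >= xi / 2] and with
[|k / n - theta| > e], for large [n] this bounds [n / g n ^ 2 * (lam_d / lam_1)] by a
constant, an event whose probability tends to [0]. Hence the event
[|khat / n - theta| > e] is covered by four events of small probability.

A probability is monotone on measurable sets only, so these four
events must be shown measurable. The two maxima are measurable by Tonelli's
theorem and the product measurability of the errors; the projections
[inner Delta v_r] are measurable since a Lipschitz functional on L^2 has open
superlevel sets ([L2borel_gt]). The latter fact, for functionals of several
elements of L^2, also brings the events of the maxima into the scope of
stationarity. *)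

(** * The Hilbert space structure of square integrable functions *)

Section inner_product.
Context {R : realType}.
Implicit Types (f g h : R -> R) (F : nat -> R -> R).

Lemma L2_cst0 : (fun=> 0) \in @L2 R.
Proof. exact: (proj1 (Lfun_addr_closed _ (lee1n 2))). Qed.

Lemma L2D f g : f \in @L2 R -> g \in @L2 R -> f \+ g \in @L2 R.
Proof. exact: (proj2 (Lfun_addr_closed _ (lee1n 2))). Qed.

Lemma L2Z (a : R) f : f \in @L2 R -> a \*o f \in @L2 R.
Proof.
move=> f2; rewrite (_ : a \*o f = a \o* f); last by apply/funext => t /=; rewrite mulrC.
by apply: Lfun_scale => //; rewrite ler1n.
Qed.

Lemma L2B f g : f \in @L2 R -> g \in @L2 R -> f \- g \in @L2 R.
Proof.
move=> f2 g2; rewrite (_ : f \- g = f \+ (-1 \*o g)); last first.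
  by apply/funext => t /=; rewrite mulN1r.
by apply: L2D => //; exact: L2Z.
Qed.

Lemma L2_sum F a b : (forall i, (a <= i < b)%N -> F i \in @L2 R) ->
  (fun t => \sum_(a <= i < b) F i t) \in @L2 R.
Proof.
elim: b => [|b IH] F2.
  rewrite (_ : (fun _ => _) = fun=> 0); first exact: L2_cst0.
  by apply/funext => t; rewrite big_geq.
have [ab|ba] := leqP a b.
  rewrite (_ : (fun _ => _) = (fun t => \sum_(a <= i < b) F i t) \+ F b).
    apply: L2D; last by apply: F2; rewrite ab ltnSn.
    by apply: IH => i /andP[ai ib]; apply: F2; rewrite ai ltnW.
  by apply/funext => t; rewrite big_nat_recr.
rewrite (_ : (fun _ => _) = fun=> 0); first exact: L2_cst0.
by apply/funext => t; rewrite big_geq.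
Qed.

Lemma L2_integrable_mul f g : f \in @L2 R -> g \in @L2 R ->
  (@leb01 R).-integrable setT (EFin \o (fun t => f t * g t)).
Proof. by move=> f2 g2; apply/Lfun1_integrable; exact: Lfun2_mul_Lfun1. Qed.

Lemma innerDl f g h : f \in @L2 R -> g \in @L2 R -> h \in @L2 R ->
  inner (f \+ g) h = inner f h + inner g h.
Proof.
move=> f2 g2 h2; rewrite /inner -RintegralD//; [|exact: L2_integrable_mul..].
by apply: eq_Rintegral => t _; rewrite mulrDl.
Qed.

Lemma innerZl a f h : f \in @L2 R -> h \in @L2 R ->
  inner (a \*o f) h = a * inner f h.
Proof.
move=> f2 h2; rewrite /inner -RintegralZl//; last exact: L2_integrable_mul.
by apply: eq_Rintegral => t _ /=; rewrite mulrA.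
Qed.

Lemma innerC f g : inner f g = inner g f.
Proof. by apply: eq_Rintegral => t _; rewrite mulrC. Qed.

Lemma innerBl f g h : f \in @L2 R -> g \in @L2 R -> h \in @L2 R ->
  inner (f \- g) h = inner f h - inner g h.
Proof.
move=> f2 g2 h2; rewrite /inner -RintegralB//; [|exact: L2_integrable_mul..].
by apply: eq_Rintegral => t _; rewrite mulrBl.
Qed.

Lemma inner_suml F a b h : (forall i, (a <= i < b)%N -> F i \in @L2 R) ->
  h \in @L2 R ->
  inner (fun t => \sum_(a <= i < b) F i t) h = \sum_(a <= i < b) inner (F i) h.
Proof.
move=> F2 h2.
have inner0 : inner (fun=> 0) h = 0.
  rewrite (_ : (fun=> 0) = 0 \*o h); last by apply/funext => t /=; rewrite mul0r.
  by rewrite innerZl// mul0r.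
elim: b F2 => [|b IH] F2.
  by rewrite big_geq// -[RHS]inner0; congr inner; apply/funext => t; rewrite big_geq.
have [ab|ba] := leqP a b; last first.
  by rewrite big_geq// -[RHS]inner0; congr inner; apply/funext => t; rewrite big_geq.
have F2' i : (a <= i < b)%N -> F i \in @L2 R.
  by move=> /andP[ai ib]; apply: F2; rewrite ai ltnW.
rewrite big_nat_recr//= -IH// -innerDl//.
- by congr inner; apply/funext => t; rewrite big_nat_recr.
- exact: L2_sum.
- by apply: F2; rewrite ab ltnSn.
Qed.

Lemma inner_aeql f g h : f \in @L2 R -> g \in @L2 R -> h \in @L2 R ->
  {ae @leb01 R, forall t, f t = g t} -> inner f h = inner g h.
Proof.
move=> f2 g2 h2 fg; congr fine; apply: ae_eq_integral => //.
- by case/integrableP : (L2_integrable_mul f2 h2).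
- by case/integrableP : (L2_integrable_mul g2 h2).
- by apply: (@filterS _ _ (ae_filter_ringOfSetsType _)) fg => t /= -> _.
Qed.

Lemma Lnorm_fineK f : f \in @L2 R ->
  ((L2norm f)%:E = 'N[@leb01 R]_2%:E[EFin \o f])%E.
Proof.
move=> /[!inE] /andP[_]; rewrite inE /= => ff; rewrite fineK//.
by rewrite ge0_fin_numE// Lnorm_ge0.
Qed.

Lemma L2norm_ge0 f : 0 <= L2norm f.
Proof. by rewrite fine_ge0// Lnorm_ge0. Qed.

Lemma L2normD f g : f \in @L2 R -> g \in @L2 R ->
  L2norm (f \+ g) <= L2norm f + L2norm g.
Proof.
move=> f2 g2; rewrite -lee_fin EFinD !Lnorm_fineK//; last exact: L2D.
apply: eminkowski; rewrite ?lee1n//.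
- by move: f2; rewrite inE => /andP[/[!inE]].
- by move: g2; rewrite inE => /andP[/[!inE]].
Qed.

Lemma L2norm_subC f g : L2norm (f \- g) = L2norm (g \- f).
Proof.
rewrite /L2norm -oppe_Lnorm; congr (fine (Lnorm _ _ _)).
by apply/funext => t /=; rewrite opprB.
Qed.

Lemma L2norm_lip f g : f \in @L2 R -> g \in @L2 R ->
  `|L2norm f - L2norm g| <= L2norm (f \- g).
Proof.
have tri u v : u \in @L2 R -> v \in @L2 R -> L2norm u <= L2norm (u \- v) + L2norm v.
  move=> u2 v2; rewrite [in leLHS](_ : u = (u \- v) \+ v).
    by apply: L2normD => //; exact: L2B.
  by apply/funext => t /=; rewrite subrK.
move=> f2 g2; rewrite ler_norml lerBlDr tri// andbT.
by rewrite lerNl opprB lerBlDr (L2norm_subC f) tri.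
Qed.

Lemma L2norm_sqr f : f \in @L2 R -> L2norm f ^+ 2 = inner f f.
Proof.
move=> f2; rewrite /inner /Rintegral -powR_mulrn ?L2norm_ge0//.
rewrite /L2norm -[X in _ `^ X]/(fine (2%:E)).
rewrite -[LHS]/(fine (_%:E)) -poweR_EFin Lnorm_fineK// powR_Lnorm//.
congr fine; apply: eq_integral => t _ /=.
by rewrite powR_mulrn// real_normK ?num_real// expr2.
Qed.

Lemma cauchy_schwarz f g : f \in @L2 R -> g \in @L2 R ->
  `|inner f g| <= L2norm f * L2norm g.
Proof.
move=> f2 g2.
have fg := L2_integrable_mul f2 g2.
apply: le_trans (le_normr_Rintegral measurableT fg) _.
rewrite -lee_fin EFinM !Lnorm_fineK// /Rintegral fineK; last first.
  by apply: integrable_fin_num => //; apply: integrable_norm.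
have := @hoelder _ _ _ (@leb01 R) f g 2 2.
rewrite Lnorm1 => H; apply: H => //.
- by move: f2; rewrite inE => /andP[/[!inE]].
- by move: g2; rewrite inE => /andP[/[!inE]].
- by rewrite [RHS]splitr !div1r.
Qed.

Lemma L2norm_sum_le F a b : (forall i, F i \in @L2 R) ->
  L2norm (fun t => \sum_(a <= i < b) F i t) <= \sum_(a <= i < b) L2norm (F i).
Proof.
move=> F2; elim: b => [|b IH].
  rewrite (_ : (fun _ => _) = cst 0); last by apply/funext => t; rewrite big_geq.
  by rewrite big_geq// /L2norm -[EFin \o _]/(cst 0%E) Lnorm0.
have [ab|ba] := leqP a b; last first.
  rewrite (_ : (fun _ => _) = cst 0); last by apply/funext => t; rewrite big_geq.
  by rewrite big_geq// /L2norm -[EFin \o _]/(cst 0%E) Lnorm0.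
rewrite (_ : (fun _ => _) = (fun t => \sum_(a <= i < b) F i t) \+ F b); last first.
  by apply/funext => t; rewrite big_nat_recr.
rewrite big_nat_recr//=; apply: le_trans (lerD IH (lexx _)).
by apply: L2normD => //; exact: L2_sum.
Qed.

End inner_product.

(** * The weighted CUSUM of a sequence with one change *)

Section cusum.
Context {R : realType}.
Implicit Types (n k : nat) (x y : nat -> R).

(** The CUSUM at [k] of a step from [1] down to [0] after the time [k0]. *)
Definition drift (n k0 k : nat) : R := (minn k k0)%:R * (n - maxn k k0)%:R / n%:R.

(** The truncated subtraction [k - k0] counts the terms after the change, which
lets one formula cover the two sides of the change point. *)
Lemma sum_change n (k0 : nat) x y (m1 mn : R) :
  (forall i, (1 <= i <= k0)%N -> x i = m1 + y i) ->
  (forall i, (k0 < i <= n)%N -> x i = mn + y i) ->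
  forall k, (k <= n)%N ->
  \sum_(1 <= i < k.+1) x i =
    k%:R * m1 + (k - k0)%:R * (mn - m1) + \sum_(1 <= i < k.+1) y i.
Proof.
move=> x1 xn; elim=> [|k IH] kn.
  by rewrite !big_geq// sub0n !mul0r !addr0.
rewrite !(@big_nat_recr _ _ _ k.+1)//= IH ?(ltnW kn)//.
have [kk0|k0k] := leqP k.+1 k0.
  rewrite x1 ?kk0// (eqP kk0) (eqP (ltnW kk0)) -natr1; ring.
rewrite xn ?k0k// subSn// -!natr1; ring.
Qed.

Lemma cusum_change n (k0 : nat) k x y (m1 mn : R) : (0 < n)%N -> (k <= n)%N ->
  (k0 <= n)%N ->
  (forall i, (1 <= i <= k0)%N -> x i = m1 + y i) ->
  (forall i, (k0 < i <= n)%N -> x i = mn + y i) ->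
  \sum_(1 <= i < k.+1) (x i - n%:R^-1 * \sum_(1 <= j < n.+1) x j) =
    ((1 - k%:R / n%:R) * \sum_(1 <= i < k.+1) y i
     - k%:R / n%:R * \sum_(k.+1 <= i < n.+1) y i)
    - drift n k0 k * (mn - m1).
Proof.
move=> n0 kn k0n x1 xn.
rewrite sumrB sumr_const_nat subSS subn0 -[in X in _ - X = _]mulr_natl.
rewrite !(sum_change x1 xn)// (@big_cat_nat _ _ _ k.+1 1 n.+1)//= /drift.
have nN0 : n%:R != 0 :> R by rewrite pnatr_eq0 -lt0n.
have [kk0|/ltnW k0k] := leqP k k0.
  by rewrite (eqP kk0) mulr0n natrB//; field.
by rewrite !natrB//; field.
Qed.

Definition amplitude n k : R := weight (k%:R / n%:R) * (Num.sqrt n%:R)^-1.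

Lemma amplitudeE n k : (0 < k < n)%N ->
  amplitude n k =
    Num.sqrt n%:R / (Num.sqrt k%:R * Num.sqrt (n - k)%:R).
Proof.
move=> /andP[k0 kn]; have n0 := leq_ltn_trans (leq0n k) kn.
rewrite /amplitude /weight.
have -> : k%:R / n%:R * (1 - k%:R / n%:R) =
          k%:R * (n - k)%:R * (n%:R ^+ 2)^-1 :> R.
  by rewrite natrB ?(ltnW kn)//; field; rewrite pnatr_eq0 -lt0n.
rewrite sqrtrM ?mulr_ge0 ?ler0n// sqrtrM ?ler0n// sqrtrV ?sqr_ge0//.
rewrite sqrtr_sqr ger0_norm ?ler0n// (_ : n%:R^-1 = (Num.sqrt n%:R ^+ 2)^-1 :> R); last first.
  by rewrite sqr_sqrtr.
field; rewrite !sqrtr_eq0 -!ltNge !ltr0n subn_gt0 n0 k0 kn//.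
Qed.

(** With [u = sqrt k], [v = sqrt (n - k)] and [s = sqrt n], so that
[s ^ 2 = u ^ 2 + v ^ 2], the expression is [v / s * (S / u) - u / s * (S' / v)]:
the weight turns the two partial sums into self-normalized ones, with
coefficients at most [1]. *)
Lemma cusum_noise_le n k (S S' b : R) : (0 < k < n)%N ->
  `|S| <= Num.sqrt k%:R * b -> `|S'| <= Num.sqrt (n - k)%:R * b ->
  `|amplitude n k * ((1 - k%:R / n%:R) * S - k%:R / n%:R * S')| <= 2 * b.
Proof.
move=> kn; rewrite (amplitudeE kn); move: kn => /andP[k0 kn].
have n0 := leq_ltn_trans (leq0n k) kn.
have -> : k%:R / n%:R = Num.sqrt k%:R ^+ 2 / Num.sqrt n%:R ^+ 2 :> R.
  by rewrite !sqr_sqrtr.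
have sumE : Num.sqrt n%:R ^+ 2 = Num.sqrt k%:R ^+ 2 + Num.sqrt (n - k)%:R ^+ 2 :> R.
  by rewrite !sqr_sqrtr// natrB ?(ltnW kn)// addrC subrK.
have : 0 < Num.sqrt n%:R :> R by rewrite sqrtr_gt0 ltr0n.
have : 0 < Num.sqrt k%:R :> R by rewrite sqrtr_gt0 ltr0n.
have : 0 < Num.sqrt (n - k)%:R :> R by rewrite sqrtr_gt0 ltr0n subn_gt0.
move: (Num.sqrt n%:R) (Num.sqrt k%:R) (Num.sqrt (n - k)%:R) sumE.
move=> s u v suv v0 u0 s0 Su Sv.
have us : u <= s by rewrite -(@ler_pXn2r _ 2)// ?nnegrE ?(ltW u0) ?(ltW s0)// suv lerDl sqr_ge0.
have vs : v <= s by rewrite -(@ler_pXn2r _ 2)// ?nnegrE ?(ltW v0) ?(ltW s0)// suv lerDr sqr_ge0.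
have b0 : 0 <= b by rewrite -(pmulr_rge0 _ u0) (le_trans _ Su).
have -> : s / (u * v) * ((1 - u ^+ 2 / s ^+ 2) * S - u ^+ 2 / s ^+ 2 * S') =
          v / s * (S / u) - u / s * (S' / v).
  rewrite (_ : 1 - u ^+ 2 / s ^+ 2 = v ^+ 2 / s ^+ 2).
    by field; rewrite !gt_eqF.
  by rewrite -[1](@divff _ (s ^+ 2)) ?sqrf_eq0 ?gt_eqF// -mulrBl suv addrAC subrr add0r.
apply: le_trans (ler_normB _ _) _.
rewrite mulr2n mulrDl mul1r; apply: lerD.
  rewrite normrM (normf_div S) (gtr0_norm u0) ger0_norm ?divr_ge0 ?(ltW v0) ?(ltW s0)//.
  rewrite -[leRHS]mul1r; apply: ler_pM; rewrite ?divr_ge0 ?(ltW v0) ?(ltW s0) ?(ltW u0)//.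
    by rewrite ler_pdivrMr// mul1r.
  by rewrite ler_pdivrMr// mulrC.
rewrite normrM (normf_div S') (gtr0_norm v0) ger0_norm ?divr_ge0 ?(ltW u0) ?(ltW s0)//.
rewrite -[leRHS]mul1r; apply: ler_pM; rewrite ?divr_ge0 ?(ltW v0) ?(ltW s0) ?(ltW u0)//.
  by rewrite ler_pdivrMr// mul1r.
by rewrite ler_pdivrMr// mulrC.
Qed.

Lemma amplitude_sqr n k : (0 < k < n)%N ->
  amplitude n k ^+ 2 = n%:R / (k%:R * (n - k)%:R).
Proof.
by move=> kn; rewrite amplitudeE// exprMn exprVn exprMn !sqr_sqrtr ?ler0n.
Qed.

Lemma signal_peak n (k0 : nat) : (0 < k0 < n)%N ->
  (amplitude n k0 * drift n k0 k0) ^+ 2 =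
  n%:R * (k0%:R / n%:R * (1 - k0%:R / n%:R)).
Proof.
move=> kn; rewrite exprMn (amplitude_sqr kn) /drift minnn maxnn.
move: kn => /andP[k00 kn]; have n0 := leq_ltn_trans (leq0n _) kn.
rewrite natrB ?(ltnW kn)//.
field; rewrite -natrB ?(ltnW kn)// !pnatr_eq0 -!lt0n subn_gt0 kn n0 k00//.
Qed.

(** The ratio of the two squares is [x (1 - t) / (t (1 - x))] for
[x = k / n <= t = k0 / n]; its distance to [1] is [(t - x) / (t (1 - x))], and
the denominator is at most [1]. The other side is symmetric. *)
Lemma signal_decay n (k0 : nat) k : (0 < k0 < n)%N -> (0 < k < n)%N ->
  (amplitude n k * drift n k0 k) ^+ 2 <=
  (1 - `|k%:R / n%:R - k0%:R / n%:R|) * (amplitude n k0 * drift n k0 k0) ^+ 2.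
Proof.
move=> k0n kn.
rewrite (exprMn _ (amplitude n k)) (exprMn _ (amplitude n k0)) !amplitude_sqr// /drift minnn maxnn.
move: k0n kn => /andP[k00 k0n] /andP[k_0 kn].
have n_0 : (0 < n)%N := leq_ltn_trans (leq0n _) kn.
have lt0 : 0 < k0%:R :> R by rewrite ltr0n.
have ltk : 0 < k%:R :> R by rewrite ltr0n.
have ltn : 0 < n%:R :> R by rewrite ltr0n.
have ltk0n : k0%:R < n%:R :> R by rewrite ltr_nat.
have ltkn : k%:R < n%:R :> R by rewrite ltr_nat.
have [kk0|/ltnW k0k] := leqP k k0.
  have : k%:R <= k0%:R :> R by rewrite ler_nat.
  rewrite !natrB ?(ltnW k0n) ?(ltnW kn)//.
  move: (k%:R) (k0%:R) (n%:R) lt0 ltk ltn ltk0n ltkn => a c m c0 a0 m0 cm am ac.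
  rewrite ler0_norm; last first.
    by rewrite -mulrBl pmulr_lle0 ?invr_gt0// subr_le0.
  have ma : m - a != 0 by rewrite subr_eq0 gt_eqF.
  have mc : m - c != 0 by rewrite subr_eq0 gt_eqF.
  rewrite -subr_ge0 (_ : _ - _ =
      (m - c) * (c - a) * (m ^+ 2 - (m - a) * c) / (m ^+ 2 * (m - a))).
    by rewrite divr_ge0 ?mulr_ge0 ?subr_ge0 ?sqr_ge0// ?ltW// expr2 ltr_pM ?subr_gt0 ?subr_ge0 ?ltW//; lra.
  by field; rewrite ?mc ?ma ?gt_eqF.
have : k0%:R <= k%:R :> R by rewrite ler_nat.
rewrite !natrB ?(ltnW k0n) ?(ltnW kn)//.
move: (k%:R) (k0%:R) (n%:R) lt0 ltk ltn ltk0n ltkn => a c m c0 a0 m0 cm am ac.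
rewrite ger0_norm; last first.
  by rewrite -mulrBl pmulr_lge0 ?invr_gt0// subr_ge0.
have ma : m - a != 0 by rewrite subr_eq0 gt_eqF.
have mc : m - c != 0 by rewrite subr_eq0 gt_eqF.
rewrite -subr_ge0 (_ : _ - _ =
    c * (a - c) * (m ^+ 2 - a * (m - c)) / (m ^+ 2 * a)).
  by rewrite divr_ge0 ?mulr_ge0 ?subr_ge0 ?sqr_ge0// ?ltW// expr2 ltr_pM ?subr_gt0 ?subr_ge0 ?ltW//; lra.
by field; rewrite ?mc ?ma ?gt_eqF.
Qed.

(** Comparison of the squared criteria of a signal [D0] and of a weaker signal
[D1], both perturbed by noise of size at most [c]. Bounding the cross terms
coordinatewise by Young's inequality, instead of bounding the norms by the
triangle inequality, keeps the whole argument at the level of squares. *)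
Lemma argmax_signal_le d (N0 N1 delta lam : nat -> R) (D0 D1 c lmin eta : R) :
  0 < eta <= 1 -> D1 ^+ 2 <= (1 - eta) * D0 ^+ 2 -> 0 < lmin ->
  (forall r, (1 <= r <= d)%N ->
     [/\ lmin <= lam r, `|N0 r| <= c & `|N1 r| <= c]) ->
  \sum_(1 <= r < d.+1) (N0 r - D0 * delta r) ^+ 2 / lam r <=
    \sum_(1 <= r < d.+1) (N1 r - D1 * delta r) ^+ 2 / lam r ->
  forall r, (1 <= r <= d)%N ->
  eta / 2 * D0 ^+ 2 * (delta r ^+ 2 / lam r) <=
    d%:R * (8 * c ^+ 2 / eta / lmin).
Proof.
move=> /andP[eta0 eta1] D10 lmin0 bnd.
rewrite -subr_ge0 -sumrB => le_crit r rd.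
have lam0 j : (1 <= j <= d)%N -> 0 < lam j.
  by move=> /bnd[+ _ _]; exact: lt_le_trans.
have key (a b D D' : R) : `|a| <= c -> `|b| <= c ->
    D' ^+ 2 <= (1 - eta) * D ^+ 2 ->
    eta / 2 * D ^+ 2 <= 8 * c ^+ 2 / eta + ((a - D) ^+ 2 - (b - D') ^+ 2).
  move=> ac bc DD.
  have sqr_le u : `|u| <= c -> u ^+ 2 <= c ^+ 2.
    by move=> uc; rewrite -real_normK ?num_real// ler_pXn2r// nnegrE (le_trans _ uc).
  have {ac} a2 := sqr_le _ ac; have {bc} b2 := sqr_le _ bc.
  (* Young's inequality with parameter [eta / 4]: each of the two cross terms
     costs [eta / 4] of the squared signal, hence [eta / 2] of it remains. *)
  pose K := 4 / eta.
  have etaE : eta = 4 * K^-1 by rewrite /K; field; rewrite gt_eqF.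
  have K1 : 1 <= K by rewrite /K ler_pdivlMr// mul1r; lra.
  have KN0 : K != 0 by rewrite gt_eqF// (lt_le_trans _ K1).
  rewrite (_ : 8 * c ^+ 2 / eta = 2 * c ^+ 2 * K); last first.
    by rewrite /K; field; rewrite gt_eqF.
  have k0 : 0 < K^-1 by rewrite invr_gt0 (lt_le_trans _ K1).
  have h1 : 0 <= K^-1 * D ^+ 2 - 2 * (a * D) + K * a ^+ 2.
    rewrite (_ : _ + _ = K^-1 * (D - K * a) ^+ 2); last by field.
    by rewrite mulr_ge0 ?sqr_ge0// ltW.
  have h2 : 0 <= K^-1 * D' ^+ 2 + 2 * (b * D') + K * b ^+ 2.
    rewrite (_ : _ + _ = K^-1 * (D' + K * b) ^+ 2); last by field.
    by rewrite mulr_ge0 ?sqr_ge0// ltW.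
  have h3 : 0 <= (K - 1) * (c ^+ 2 - a ^+ 2) by rewrite mulr_ge0 ?subr_ge0.
  have h4 : 0 <= (1 + K) * (c ^+ 2 - b ^+ 2).
    by rewrite mulr_ge0 ?subr_ge0// addr_ge0// (le_trans _ K1).
  clearbody K; move: DD; rewrite etaE; move: (K^-1) k0 h1 h2 => e e0 h1 h2 DD.
  have h5 : 0 <= (1 + e) * ((1 - 4 * e) * D ^+ 2 - D' ^+ 2).
    by rewrite mulr_ge0 ?subr_ge0// addr_ge0// ltW.
  have h6 : 0 <= e * e * D ^+ 2 by rewrite mulr_ge0 ?sqr_ge0// -expr2 sqr_ge0.
  rewrite sqrrB [(b - D') ^+ 2]sqrrB; clear -h1 h2 h3 h4 h5 h6. lra.
(* The differences of the criteria have no sign in a single coordinate, only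
   their sum has; so all coordinates are summed before they are dropped. *)
pose gap j := 8 * c ^+ 2 / eta / lmin +
  ((N0 j - D0 * delta j) ^+ 2 / lam j - (N1 j - D1 * delta j) ^+ 2 / lam j).
have term j : (1 <= j <= d)%N ->
    eta / 2 * D0 ^+ 2 * (delta j ^+ 2 / lam j) <= gap j.
  move=> jd; have [lj n0 n1] := bnd j jd; have l0 := lam0 j jd.
  have := key (N0 j) (N1 j) (D0 * delta j) (D1 * delta j) n0 n1.
  rewrite !exprMn [(1 - _) * _]mulrA => /(_ (ler_wpM2r (sqr_ge0 _) D10)).
  rewrite -(ler_pM2r (_ : 0 < (lam j)^-1)) ?invr_gt0// => crit_j.
  rewrite (mulrA _ _ (lam j)^-1) -(mulrA (eta / 2)).
  apply: le_trans crit_j _; rewrite mulrDl mulrBl lerD2r ler_wpM2l ?lef_pV2 ?posrE//.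
  by apply: divr_ge0; [apply: mulr_ge0 => //; exact: sqr_ge0|exact: ltW].
apply: (@le_trans _ _
    (\sum_(1 <= j < d.+1) eta / 2 * D0 ^+ 2 * (delta j ^+ 2 / lam j))).
  rewrite (bigD1_seq r) ?iota_uniq ?mem_index_iota//= lerDl.
  rewrite big_nat_cond; apply: sumr_ge0 => j /andP[/lam0 l0 _].
  apply: mulr_ge0; last by rewrite divr_ge0 ?sqr_ge0 ?(ltW l0).
  by apply: mulr_ge0; [rewrite divr_ge0 ?(ltW eta0)|exact: sqr_ge0].
apply: (@le_trans _ _ (\sum_(1 <= j < d.+1) gap j)).
  by rewrite big_nat [leRHS]big_nat; apply: ler_sum => j; exact: term.
rewrite big_split/= sumr_const_nat subSS subn0 -[X in X + _]mulr_natl.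
by rewrite gerDl -oppr_ge0 -sumrN; under eq_bigr do rewrite opprB.
Qed.

End cusum.

(** * Lipschitz functionals and measurability *)

Section lipschitz.
Context {R : realType}.
Variable m : nat.
Implicit Types (phi psi : ('I_m -> R -> R) -> R).

(** A global Lipschitz bound for the sum of the L^2 distances: stable under the
operations that build a maximum of partial sums, and enough for openness. *)
Definition L2lipschitz phi := exists2 C : R, 0 <= C &
  forall x y, L2pow x -> L2pow y ->
    `|phi y - phi x| <= C * \sum_j L2norm (y j \- x j).

(** If [K > C m] then all [y] whose coordinates are within [(phi x - a) / K] of
those of [x] still satisfy [a < phi y]. *)
Lemma L2open_gt phi (a : R) : L2lipschitz phi ->
  L2open [set x | L2pow x /\ a < phi x].
Proof.
move=> [C C0 lip]; split => [x [] //|x [x2 ax]].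
pose K : R := C * m%:R + 1.
have K0 : 0 < K by rewrite ltr_wpDl// mulr_ge0.
exists ((phi x - a) / K) => [|y y2 xy]; first by rewrite divr_gt0// subr_gt0.
split=> //; have := lip x y x2 y2.
have le_sum : C * \sum_j L2norm (y j \- x j) <= C * (m%:R * ((phi x - a) / K)).
  rewrite ler_wpM2l// (le_trans (ler_sum _ (fun j _ => ltW (xy j))))//.
  by rewrite sumr_const card_ord mulr_natl.
have lt_gap : C * (m%:R * ((phi x - a) / K)) < phi x - a.
  rewrite mulrA mulrCA gtr_pMr ?subr_gt0// ltr_pdivrMr// mul1r /K.
  by rewrite ltrDl.
move=> /le_trans/(_ le_sum)/le_lt_trans/(_ lt_gap).
by rewrite ltr_norml => /andP[]; rewrite opprB ltrBrDr subrK.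
Qed.

Lemma L2borel_gt phi (a : R) : L2lipschitz phi ->
  L2borel [set x | L2pow x /\ a < phi x].
Proof. by move=> /(L2open_gt a) ?; exact: sub_sigma_algebra. Qed.

Lemma L2lipschitz_cst (a : R) : L2lipschitz (fun=> a).
Proof. by exists 0 => // x y _ _; rewrite subrr normr0 mul0r. Qed.

Lemma L2lipschitz_scale (a : R) phi : L2lipschitz phi ->
  L2lipschitz (fun x => a * phi x).
Proof.
move=> [C C0 lip]; exists (`|a| * C); first by rewrite mulr_ge0.
by move=> x y x2 y2; rewrite -mulrBr normrM -mulrA ler_wpM2l// lip.
Qed.

Lemma L2lipschitz_max phi psi : L2lipschitz phi -> L2lipschitz psi ->
  L2lipschitz (fun x => Num.max (phi x) (psi x)).
Proof.
move=> [C C0 lipC] [D D0 lipD]; exists (C + D); first by rewrite addr_ge0.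
move=> x y x2 y2; rewrite mulrDl.
have := lipC _ _ x2 y2; have := lipD _ _ x2 y2.
have S0 : 0 <= \sum_j L2norm (y j \- x j).
  by apply: sumr_ge0 => j _; exact: L2norm_ge0.
have := mulr_ge0 C0 S0; have := mulr_ge0 D0 S0.
move: (C * _) (D * _) => u v v0 u0; rewrite !ler_norml => /andP[? ?] /andP[? ?].
by case: (ltP (phi x)); case: (ltP (phi y)) => ? ?; lra.
Qed.

Lemma L2lipschitz_bigmax (I : Type) (s : seq I) (F : I -> ('I_m -> R -> R) -> R) :
  (forall i, L2lipschitz (F i)) ->
  L2lipschitz (fun x => \big[Num.max/0]_(i <- s) F i x).
Proof.
move=> lipF; elim: s => [|i s IH].
  by under eq_fun do rewrite big_nil; exact: L2lipschitz_cst.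
by under eq_fun do rewrite big_cons; exact: L2lipschitz_max.
Qed.

Lemma L2lipschitz_norm_sum (s : nat -> 'I_m) a b :
  L2lipschitz (fun x => L2norm (fun t => \sum_(a <= i < b) x (s i) t)).
Proof.
exists (b - a)%:R => // x y x2 y2.
have sum2 z : L2pow z -> (fun t => \sum_(a <= i < b) z (s i) t) \in @L2 R.
  by move=> z2; exact: L2_sum.
apply: le_trans (L2norm_lip (sum2 _ y2) (sum2 _ x2)) _.
rewrite (_ : _ \- _ = fun t => \sum_(a <= i < b) (y (s i) \- x (s i)) t); last first.
  by apply/funext => t /=; rewrite sumrB.
have le_norm i : L2norm (y (s i) \- x (s i)) <= \sum_j L2norm (y j \- x j).
  by rewrite (bigD1 (s i))//= lerDl sumr_ge0// => j _; exact: L2norm_ge0.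
rewrite mulr_natl -sumr_const_nat.
apply: le_trans (ler_sum _ (fun i _ => le_norm i)).
by apply: L2norm_sum_le => i; exact: L2B.
Qed.

Lemma L2lipschitz_inner f (j : 'I_m) : f \in @L2 R ->
  L2lipschitz (fun x => inner f (x j)).
Proof.
move=> f2; exists (L2norm f) => [|x y x2 y2]; first exact: L2norm_ge0.
rewrite !(innerC f) -innerBl// innerC.
apply: le_trans (cauchy_schwarz f2 (L2B (y2 j) (x2 j))) _.
rewrite ler_wpM2l ?L2norm_ge0// (bigD1 j)//= lerDl sumr_ge0// => i _.
exact: L2norm_ge0.
Qed.

End lipschitz.

Section measurability.
Context {R : realType} {disp : measure_display} {T : measurableType disp}.

(** Tonelli's theorem: the squared norm is a partial integral of a nonnegative
jointly measurable function. *)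
Lemma measurable_L2norm (Z : T -> R -> R) : product_measurable Z ->
  measurable_fun setT (fun w => L2norm (Z w)).
Proof.
move=> mZ.
pose F : T -> \bar R := fun w => fubini_F (@leb01 R) (fun z => (`|Z z.1 z.2| `^ 2)%:E) w.
have -> : (fun w => L2norm (Z w)) = fine \o ((poweR ^~ 2^-1) \o F).
  by apply/funext => w; rewrite /L2norm unlock.
have mF : measurable_fun setT F.
  apply: measurable_fun_fubini_tonelli_F => [|z]; last first.
    by rewrite lee_fin powR_ge0.
  apply/measurable_EFinP.
  apply: (measurableT_comp (measurable_powR _)).
  exact: measurableT_comp.
have mp := measurableT_comp (measurable_poweR 2^-1) mF.
exact: (measurableT_comp (fine_measurable measurableT) mp).
Qed.

Lemma measurable_bigmaxr (I : Type) (s : seq I) (F : I -> T -> R) :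
  (forall i, measurable_fun setT (F i)) ->
  measurable_fun setT (fun w => \big[Num.max/0]_(i <- s) F i w).
Proof.
move=> mF; elim: s => [|i s IH].
  by under eq_fun do rewrite big_nil; exact: measurable_cst.
by under eq_fun do rewrite big_cons; exact: measurable_maxr.
Qed.

Lemma measurable_max_partial_sum (Z : nat -> T -> R -> R) n :
  (forall i, product_measurable (Z i)) ->
  measurable_fun setT (max_partial_sum Z n).
Proof.
move=> mZ; apply: measurable_bigmaxr => k.
apply: measurable_funM => //; apply: measurable_L2norm.
by apply: measurable_sum => i; exact: mZ.
Qed.

(** Unlike norms of errors, these projections involve processes that need not be
jointly measurable; Borel measurability in L^2 is enough as the superlevel sets
of [inner f] are open. *)
Lemma measurable_inner (f : R -> R) (Z : T -> R -> R) : f \in @L2 R ->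
  random_L2 Z -> measurable_fun setT (fun w => inner f (Z w)).
Proof.
move=> f2 [Z2 mZ] _; apply: (measurability _ (RGenOInfty.measurableE R)) => //.
move=> _ [_ [a ->] <-].
rewrite setTI; have /mZ := L2borel_gt a (L2lipschitz_inner (@ord0 0) f2).
congr (measurable _); apply/seteqP; split => w /=; rewrite in_itv/= andbT.
  by case.
by move=> h; split=> // j; exact: Z2.
Qed.

End measurability.

(** * Maxima of partial sums of a stationary sequence *)

Section partial_sums.
Context {R : realType} {disp : measure_display} {T : measurableType disp}.
Implicit Types (Z : nat -> T -> R -> R).

Lemma max_partial_sum_ge0 Z n w : 0 <= max_partial_sum Z n w.
Proof. exact: bigmax_ge_id. Qed.

Lemma partial_sum_le Z n k w : (forall i, Z i w \in @L2 R) -> (k < n)%N ->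
  L2norm (fun t => \sum_(1 <= i < k.+1) Z i w t)
    <= Num.sqrt k%:R * max_partial_sum Z n w.
Proof.
move=> Z2; case: k => [|k] kn.
  rewrite sqrtr0 mul0r (_ : (fun _ => _) = cst 0).
    by rewrite /L2norm -[EFin \o _]/(cst 0%E) Lnorm0.
  by apply/funext => t; rewrite big_geq.
rewrite -ler_pdivrMl ?sqrtr_gt0 ?ltr0n// /max_partial_sum.
by apply: (@Order.TotalTheory.bigmax_sup_seq _ R _ _ 0 k.+1) => //; rewrite mem_index_iota.
Qed.

Variable P : probability T R.
Variable Y : int -> T -> R -> R.
Hypothesis Y2 : forall i w, Y i w \in @L2 R.
Hypothesis Ystationary : strictly_stationary P Y.

(* Ordinals start at [0] and the partial sums at [1]: with [n.+1] elements of
   L^2, the summand of index [i] is simply the one at [inord i]. *)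
Let path_max n (x : 'I_n.+1 -> R -> R) : R :=
  \big[Num.max/0]_(1 <= k < n) ((Num.sqrt k%:R)^-1 *
     L2norm (fun t => \sum_(1 <= i < k.+1) x (inord i) t)).

Let path_maxE (f : nat -> int) n w :
  max_partial_sum (fun i => Y (f i)) n w =
  path_max (fun j : 'I_n.+1 => Y (f j) w).
Proof.
rewrite /max_partial_sum /path_max; apply: eq_big_nat => k /andP[_ kn].
congr (_ * L2norm _); apply/funext => t; apply: eq_big_nat => i /andP[_ ik].
by rewrite inordK// ltnS (leq_trans _ (ltnW kn)).
Qed.

(** Stationarity speaks of Borel sets of finite families; the superlevel sets
of the maximum of the partial sums are such sets. *)
Lemma max_partial_sum_shift (f : nat -> int) (h : int) n (a : R) :
  P [set w | a < max_partial_sum (fun i => Y (f i + h)) n w] =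
  P [set w | a < max_partial_sum (fun i => Y (f i)) n w].
Proof.
have lip : L2lipschitz (@path_max n).
  by apply: L2lipschitz_bigmax => k; apply: L2lipschitz_scale; exact: L2lipschitz_norm_sum.
have := Ystationary (fun j : 'I_n.+1 => f j) h (L2borel_gt a lip).
have setE (u : nat -> int) :
    [set w | a < max_partial_sum (fun i => Y (u i)) n w] =
    [set w | [set x | L2pow x /\ a < path_max x] (fun j : 'I_n.+1 => Y (u j) w)].
  by apply/seteqP; split => w /=; rewrite path_maxE; [split|case].
by rewrite -(setE f) -(setE (fun i => f i + h)).
Qed.

End partial_sums.

(** * The criterion and its maximizers *)

Section criterion.
Context {R : realType} {disp : measure_display} {T : measurableType disp}.
Variables (mu : nat -> nat -> R -> R) (Y : int -> T -> R -> R).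
Variables (vhat : nat -> nat -> T -> R -> R) (lamhat : nat -> nat -> T -> R).
Variables (theta : R) (Delta : R -> R).
Hypothesis HA : alternative theta Delta mu.
Hypothesis Y2 : forall i w, Y i w \in @L2 R.
Hypothesis vhat_on : orthonormal_estimates vhat.
Hypothesis lamhat_ev : eigenvalue_estimates lamhat.

Let X := observation mu Y.
Let cp n := Num.truncn (n%:R * theta).

Let v2 n r w : (1 <= r)%N -> vhat n r w \in @L2 R.
Proof. by move=> r1; case: (vhat_on) => /(_ n r r1)[]. Qed.

Let vnorm n r w : (1 <= r)%N -> L2norm (vhat n r w) = 1.
Proof.
move=> r1; apply/eqP; rewrite -(@eqrXn2 _ 2) ?L2norm_ge0//.
by rewrite L2norm_sqr ?v2// (vhat_on.2 _ _ _ _ r1 r1) eqxx expr1n.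
Qed.

Let X2 n i w : (1 <= i <= n)%N -> X n i w \in @L2 R.
Proof.
case: HA => _ _ mu2 _ /mu2 mi2.
by rewrite (_ : X n i w = mu n i \+ Y i%:Z w)//; exact: L2D.
Qed.

Lemma lamhat_anti n r s w : (1 <= r <= s)%N -> lamhat n s w <= lamhat n r w.
Proof.
move=> /andP[r1]; elim: s => [|s IH]; first by case: r r1.
rewrite leq_eqVlt => /orP[/eqP <-//|/[!ltnS] rs].
apply: le_trans (IH rs).
by have [_ /(_ w)[]] := lamhat_ev n (leq_trans r1 rs).
Qed.

Lemma score_inner n k r w : (0 < n)%N -> (k <= n)%N -> (1 <= r)%N ->
  score X vhat n k r w = (Num.sqrt n%:R)^-1 *
    \sum_(1 <= i < k.+1) (inner (X n i w) (vhat n r w) -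
       n%:R^-1 * \sum_(1 <= j < n.+1) inner (X n j w) (vhat n r w)).
Proof.
move=> n0 kn r1; have vr := v2 n w r1; congr (_ * _).
have sumX2 : (fun t => \sum_(1 <= j < n.+1) X n j w t) \in @L2 R.
  by apply: L2_sum => j; rewrite ltnS; exact: X2.
have mean2 : sample_mean X n w \in @L2 R by exact: L2Z.
rewrite -[LHS]/(inner (fun t => \sum_(1 <= i < k.+1)
  (X n i w \- sample_mean X n w) t) (vhat n r w)).
have Xi2 i : (1 <= i < k.+1)%N -> X n i w \in @L2 R.
  by move=> /andP[i1 ik]; apply: X2; rewrite i1 (leq_trans _ kn).
rewrite inner_suml//; last by move=> i /Xi2 ?; exact: L2B.
apply: eq_big_nat => i /Xi2 Xi; rewrite innerBl//; congr (_ - _).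
rewrite -[sample_mean _ _ _]/(n%:R^-1 \*o (fun t => \sum_(1 <= j < n.+1) X n j w t)).
by rewrite innerZl// inner_suml// => j; rewrite ltnS; exact: X2.
Qed.

(* The errors in reverse order: the [i]-th one is [Y (n + 1 - i)]. *)
Let reversed n := max_partial_sum (fun i => Y (- i%:Z + n.+1%:Z)) n.

Let tail_sum n k w t : (k <= n)%N ->
  \sum_(k.+1 <= i < n.+1) Y i%:Z w t =
  \sum_(1 <= j < (n - k).+1) Y (- j%:Z + n.+1%:Z) w t.
Proof.
move=> kn; rewrite [RHS]big_nat_rev/= -add1n big_addn subSn//.
apply: eq_big_nat => i /andP[i1 ink]; congr (Y _ w t); lia.
Qed.

(** The decomposition into noise and signal. Everything is first projected on
[vhat n r w], where the means take two values only, and the noise is controlled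
by Cauchy-Schwarz since [vhat n r w] is a unit vector. *)
Lemma weighted_score n k r (b : R) w : (0 < k < n)%N -> (1 <= r)%N ->
  (1 <= cp n)%N -> (cp n <= n)%N ->
  max_partial_sum (fun i => Y i%:Z) n w <= b -> reversed n w <= b ->
  exists2 N : R, `|N| <= 2 * b &
    weight (k%:R / n%:R) * score X vhat n k r w =
    N - amplitude n k * drift n (cp n) k * inner Delta (vhat n r w).
Proof.
move=> kn r1 cp1 cpn fwd bwd; have /andP[k0 ltkn] := kn.
have n0 := leq_ltn_trans (leq0n k) ltkn; have vr := v2 n w r1.
case: HA => _ [D2 _] mu2 /(_ n cp1)[mu_l mu_r muD].
pose y (i : nat) := inner (Y i%:Z w) (vhat n r w).
have innerX i : (1 <= i <= n)%N ->
    inner (X n i w) (vhat n r w) = inner (mu n i) (vhat n r w) + y i.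
  by move=> i1n; rewrite -innerDl// mu2.
have n1n : (1 <= 1 <= n)%N by [].
have nnn : (1 <= n <= n)%N by rewrite n0 leqnn.
have Dv : inner Delta (vhat n r w) =
    inner (mu n n) (vhat n r w) - inner (mu n 1) (vhat n r w).
  rewrite -innerBl ?mu2//; apply: inner_aeql => //; first by apply: L2B; exact: mu2.
  by apply: (@filterS _ _ (ae_filter_ringOfSetsType _)) muD => t /= ->.
exists (amplitude n k * ((1 - k%:R / n%:R) * \sum_(1 <= i < k.+1) y i -
    k%:R / n%:R * \sum_(k.+1 <= i < n.+1) y i)).
  have le_norm (F : nat -> R -> R) m :
      (forall i, F i \in @L2 R) ->
      `|\sum_(1 <= i < m.+1) inner (F i) (vhat n r w)| <=
        L2norm (fun t => \sum_(1 <= i < m.+1) F i t).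
    move=> F2; rewrite -inner_suml//.
    by apply: le_trans (cauchy_schwarz _ vr) _; rewrite ?vnorm ?mulr1// L2_sum.
  apply: cusum_noise_le => //.
    apply: le_trans (le_norm (fun i => Y i%:Z w) _ _) _ => //.
    apply: le_trans (partial_sum_le (Z := fun i => Y i%:Z) _ ltkn) _ => //.
    by rewrite ler_wpM2l ?sqrtr_ge0.
  rewrite -[\sum_(_ <= i < _) _](@inner_suml _ (fun i => Y i%:Z w))//.
  rewrite (_ : (fun _ => _) = fun t =>
      \sum_(1 <= j < (n - k).+1) Y (- j%:Z + n.+1%:Z) w t); last first.
    by apply/funext => t; rewrite tail_sum// ltnW.
  rewrite inner_suml//.
  apply: le_trans (le_norm (fun j => Y (- j%:Z + n.+1%:Z) w) _ _) _ => //.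
  apply: le_trans (partial_sum_le (Z := fun j => Y (- j%:Z + n.+1%:Z)) (n := n) _ _) _ => //.
    lia.
  by rewrite ler_wpM2l ?sqrtr_ge0.
rewrite score_inner// ?(ltnW ltkn)// mulrA -/(amplitude n k).
rewrite (@cusum_change _ n (cp n) k _ y (inner (mu n 1) (vhat n r w))
           (inner (mu n n) (vhat n r w)))// ?(ltnW ltkn)//.
- by rewrite -Dv mulrBr mulrA.
- move=> i /andP[i1 icp]; have i1n : (1 <= i <= n)%N by rewrite i1 (leq_trans icp).
  rewrite innerX//; congr (_ + _); apply: inner_aeql; rewrite ?mu2//.
  by apply: mu_l; rewrite i1.
- move=> i /andP[cpi iln]; have i1n : (1 <= i <= n)%N by rewrite iln (leq_ltn_trans _ cpi).
  rewrite innerX//; congr (_ + _); apply: inner_aeql; rewrite ?mu2//.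
  by apply: mu_r; rewrite cpi.
Qed.

(** Moving the weight under the square root turns the comparison of two criteria
into a comparison of weighted sums of squares. *)
Lemma criterionE d n k w : 
  criterion X vhat lamhat d n k w = Num.sqrt (\sum_(1 <= r < d.+1)
    (weight (k%:R / n%:R) * score X vhat n k r w) ^+ 2 / lamhat n r w).
Proof.
have w0 : 0 <= weight (k%:R / n%:R) :> R by rewrite invr_ge0 sqrtr_ge0.
rewrite /criterion -[X in X * _](ger0_norm w0) -sqrtr_sqr -sqrtrM ?sqr_ge0//.
by rewrite mulr_sumr; under eq_bigr do rewrite mulrA -exprMn.
Qed.

(** The deterministic heart of the proof: on the event where [b] bounds both
maxima, a time [k] that beats the change point must be close to it. *)
Lemma argmax_localization d n k r (b : R) w :
  (0 < k < n)%N -> (0 < cp n < n)%N -> (1 <= r <= d)%N ->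
  0 < lamhat n d w ->
  max_partial_sum (fun i => Y i%:Z) n w <= b -> reversed n w <= b ->
  criterion X vhat lamhat d n (cp n) w <= criterion X vhat lamhat d n k w ->
  `|k%:R / n%:R - (cp n)%:R / n%:R| ^+ 2 *
     (n%:R * ((cp n)%:R / n%:R * (1 - (cp n)%:R / n%:R))) *
     inner Delta (vhat n r w) ^+ 2 * lamhat n d w <=
  64 * d%:R * b ^+ 2 * lamhat n 1 w.
Proof.
move=> kn cpn rd lamd fwd bwd crit; pose tau : R := (cp n)%:R / n%:R; rewrite -/tau.
have /andP[cp0 ltcpn] := cpn; have /andP[k0 ltkn] := kn.
have n0 := leq_ltn_trans (leq0n k) ltkn.
have lam0 j : (1 <= j <= d)%N -> 0 < lamhat n j w.
  by move=> jd; apply: lt_le_trans lamd _; exact: lamhat_anti.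
have lam1 : 0 < lamhat n 1 w by apply: lam0; lia.
have rhs0 : 0 <= 64 * d%:R * b ^+ 2 * lamhat n 1 w.
  by apply: mulr_ge0; [apply: mulr_ge0; [exact: mulr_ge0|exact: sqr_ge0]|exact: ltW].
have [->|eta_neq0] := eqVneq (k%:R / n%:R) tau.
  by rewrite subrr normr0 expr0n /= !mul0r.
have frac01 j : (0 < j < n)%N -> 0 < (j%:R / n%:R : R) < 1.
  move=> /andP[j0 jn]; rewrite divr_gt0 ?ltr0n//=.
  by rewrite ltr_pdivrMr ?ltr0n// mul1r ltr_nat.
have /andP[x0 x1] := frac01 k kn; have /andP[t0 t1] := frac01 _ cpn.
have tauE : (cp n)%:R / n%:R = tau by [].
rewrite tauE in t0 t1; clearbody tau.
set eta := `|_ - _|.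
have eta01 : 0 < eta <= 1.
  rewrite normr_gt0 subr_eq0 eta_neq0 /= ler_norml.
  by apply/andP; split; lra.
pose noise j r := weight (j%:R / n%:R) * score X vhat n j r w +
  amplitude n j * drift n (cp n) j * inner Delta (vhat n r w).
have noise_le j s : (0 < j < n)%N -> (1 <= s <= d)%N -> `|noise j s| <= 2 * b.
  move=> jn /andP[s1 _].
  have [N Nb E] := weighted_score jn s1 cp0 (ltnW ltcpn) fwd bwd.
  by rewrite /noise E subrK.
have := crit; rewrite !criterionE ler_sqrt; last first.
  rewrite big_nat_cond; apply: sumr_ge0 => j /andP[jd _].
  by apply: divr_ge0; [exact: sqr_ge0|apply/ltW/lam0].
have unfold_noise j s : weight (j%:R / n%:R) * score X vhat n j s w =
    noise j s - amplitude n j * drift n (cp n) j * inner Delta (vhat n s w).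
  by rewrite /noise addrK.
under eq_bigr do rewrite unfold_noise.
under [X in _ <= X -> _]eq_bigr do rewrite unfold_noise.
move=> le_sum.
have bnd s : (1 <= s <= d)%N -> [/\ lamhat n d w <= lamhat n s w,
    `|noise (cp n) s| <= 2 * b & `|noise k s| <= 2 * b].
  by move=> sd; split; [exact: lamhat_anti|exact: noise_le|exact: noise_le].
have := @signal_decay R _ _ _ cpn kn; rewrite tauE => decay.
have := argmax_signal_le eta01 decay lamd bnd le_sum rd.
rewrite signal_peak// tauE.
set A := n%:R * _; set D2 := _ ^+ 2.
have lamr : lamhat n r w <= lamhat n 1 w by apply: lamhat_anti; case/andP: rd => ->.
have A0 : 0 <= A.
  by rewrite /A !mulr_ge0 ?ler0n ?(ltW t0)// subr_ge0 ltW.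
have /andP[eta0 eta1] := eta01.
move=> main.
have {}main : eta / 2 * A * (D2 / lamhat n 1 w) <=
    d%:R * (8 * (2 * b) ^+ 2 / eta / lamhat n d w).
  apply: le_trans main; apply: ler_wpM2l.
    by apply: mulr_ge0 => //; rewrite divr_ge0 // ltW.
  by apply: ler_wpM2l; [exact: sqr_ge0|rewrite lef_pV2 ?posrE// lam0].
have pos : 0 < 2 * eta * lamhat n 1 w * lamhat n d w by rewrite !mulr_gt0.
rewrite -(ler_pM2r pos) in main.
apply: le_trans (le_trans _ main) _; rewrite le_eqVlt; apply/orP; left; apply/eqP.
  by field; rewrite gt_eqF.
by field; rewrite !gt_eqF.
Qed.

End criterion.

(** * Convergence in probability of the change-point estimate *)

Section probability.
Context {R : realType} {disp : measure_display} {T : measurableType disp}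
        (P : probability T R).

Lemma cvg_measure0P (A : nat -> set T) :
  P (A n) @[n --> \oo] --> 0%E <->
  forall e : R, 0 < e -> \forall n \near \oo, (P (A n) <= e%:E)%E.
Proof.
have small (e : R) (x : \bar R) : (0 <= x)%E -> (x <= e%:E)%E ->
    x \is a fin_num /\ `|fine x| <= e.
  move=> x0 xe; have xf : x \is a fin_num.
    by rewrite ge0_fin_numE// (le_lt_trans xe) ?ltry.
  by split=> //; rewrite -(fineK xf) lee_fin in x0 xe; rewrite ger0_norm.
split=> [/fine_cvgP[Afin /cvgr0Pnorm_le A0] e e0|A0].
  near=> n; have nf : P (A n) \is a fin_num by near: n.
  rewrite -(fineK nf) lee_fin; apply: le_trans (ler_norm _) _.
  by near: n; exact: A0.
apply/fine_cvgP; split.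
  apply: filterS (A0 1 ltr01) => n /small[]//.
apply/cvgr0Pnorm_le => e e0.
by apply: filterS (A0 e e0) => n /small[].
Unshelve. all: by end_near. Qed.

Lemma measurable_gt (f : T -> R) (a : R) :
  measurable_fun setT f -> measurable [set w | a < f w].
Proof.
move=> mf; rewrite -[X in measurable X]setTI.
rewrite (_ : [set w | _] = f @^-1` `]a, +oo[%classic); first exact: mf.
by apply/seteqP; split => w /=; rewrite in_itv/= andbT.
Qed.

(** Clearing the denominator avoids the measurability of the inverse. Where
[h w = 0], both inequalities hold, since then [f w = 0] as well. *)
Lemma measurable_ratio_le (f h : T -> R) (c M : R) :
  measurable_fun setT f -> measurable_fun setT h ->
  (forall w, 0 <= f w <= h w) -> 0 <= M ->
  measurable [set w | c * (f w / h w) <= M].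
Proof.
move=> mf mh fh M0.
rewrite (_ : [set w | _] = setT `&` [set w | c * f w <= M * h w]).
  by apply: measurable_fun_le => //; exact: measurable_funM.
rewrite setTI; apply/seteqP; split => w /=; have /andP[f0 fw] := fh w.
  have [h0|h0] := eqVneq (h w) 0.
    have -> : f w = 0 by apply/eqP; rewrite eq_le f0 -h0 fw.
    by rewrite h0 !mulr0.
  have {h0}hp : 0 < h w by rewrite lt_neqAle eq_sym h0 (le_trans f0).
  by rewrite mulrA ler_pdivrMr.
have [h0|h0] := eqVneq (h w) 0; first by rewrite h0 invr0 !mulr0.
have {h0}hp : 0 < h w by rewrite lt_neqAle eq_sym h0 (le_trans f0).
by rewrite mulrA ler_pdivrMr.
Qed.

Lemma measure_setU4_le (A B C D E : set T) (a b c d : R) :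
  measurable A -> measurable B -> measurable C -> measurable D -> measurable E ->
  E `<=` A `|` B `|` C `|` D ->
  (P A <= a%:E)%E -> (P B <= b%:E)%E -> (P C <= c%:E)%E -> (P D <= d%:E)%E ->
  (P E <= (a + b + c + d)%:E)%E.
Proof.
move=> mA mB mC mD mE sub PA PB PC PD.
have mAB := measurableU _ _ mA mB; have mABC := measurableU _ _ mAB mC.
apply: (@le_trans _ _ (P (A `|` B `|` C `|` D))).
  by apply: le_measure => //; rewrite inE//; exact: measurableU.
rewrite !EFinD; apply: le_trans (measureU2 _ mABC mD) _; apply: leeD => //.
apply: le_trans (measureU2 _ mAB mC) _; apply: leeD => //.
by apply: le_trans (measureU2 _ mA mB) _; exact: leeD.
Qed.

End probability.

Lemma truncn_fraction (R : realType) (theta delta : R) :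
  0 < theta < 1 -> 0 < delta -> \forall n \near \oo,
  (0 < Num.truncn (n%:R * theta) < n)%N /\
  `|(Num.truncn (n%:R * theta))%:R / n%:R - theta| <= delta.
Proof.
move=> /andP[th0 th1] delta0; near=> n.
have n_theta : theta^-1 < n%:R by near: n; exact: nbhs_infty_gtr.
have n_delta : delta^-1 < n%:R by near: n; exact: nbhs_infty_gtr.
have n0 : 0 < n%:R :> R by apply: lt_trans n_theta; rewrite invr_gt0.
have nth : 1 < n%:R * theta by rewrite -ltr_pdivrMr// div1r.
have ndelta : 1 < n%:R * delta by rewrite -ltr_pdivrMr// div1r.
have k0_gt0 : (0 < Num.truncn (n%:R * theta))%N by rewrite truncn_gt0 ltW.
have /truncn_itv := ltW (lt_trans ltr01 nth).
move: (Num.truncn _) k0_gt0 => k0 k0_gt0; rewrite -natr1 => /andP[k0le k0gt].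
split.
  by rewrite k0_gt0 -(ltr_nat R) (le_lt_trans k0le)// gtr_pMr.
rewrite ler_norml lerBrDr ler_pdivlMr// lerBlDr ler_pdivrMr//.
by apply/andP; split; lra.
Unshelve. all: by end_near. Qed.

Theorem theorem3p8 (R : realType) (disp : measure_display)
    (T : measurableType disp) (P : probability T R)
    (Y : int -> T -> R -> R) (nu : R)
    (zeta : measurableTypeR R * measurableTypeR R -> R)
    (lam : nat -> R) (v : nat -> R -> R)
    (theta : R) (Delta : R -> R) (mu : nat -> nat -> R -> R)
    (d : nat) (g : nat -> R)
    (vhat : nat -> nat -> T -> R -> R) (lamhat : nat -> nat -> T -> R)
    (khat : nat -> T -> nat)
    (Yrandom : forall i, random_L2 (Y i) /\ product_measurable (Y i))
    (Ycentered : forall i, centered P (Y i))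
    (Ystationary : strictly_stationary P Y)
    (nu_gt2 : 2 < nu)
    (Ymoment : ('E_P[(fun w => (L2norm (Y 1 w) `^ nu)%R)] < +oo)%E)
    (HA : alternative theta Delta mu)
    (d_gt0 : (1 <= d)%N)
    (zeta_lrc : long_run_cov P Y zeta)
    (zeta_eigen : eigensystem zeta lam v)
    (lam_d_gt0 : 0 < lam d)
    (vhat_on : orthonormal_estimates vhat)
    (lamhat_ev : eigenvalue_estimates lamhat)
    (g_gt0 : forall n, 0 < g n)
    (P1_forward : bigO_in_probability P
       (max_partial_sum (fun i => Y i%:Z)) g)
    (P1_backward : bigO_in_probability P
       (max_partial_sum (fun i => Y (- i%:Z))) g)
    (B2 : exists (r : nat) (xi : R), [/\ (1 <= r <= d)%N, 0 < xi &
       cvg_in_probability P (fun n w => `|inner Delta (vhat n r w)|) xi])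
    (E1 : diverges_in_probability P
       (fun n w => n%:R / g n ^+ 2 * (lamhat n d w / lamhat n 1%N w)))
    (khat_argmax :
       argmax_estimator (observation mu Y) vhat lamhat d khat) :
  cvg_in_probability P (fun n w => (khat n w)%:R / n%:R) theta.
Proof.
have Y2 i w : Y i w \in @L2 R by case: (Yrandom i) => -[].
have mY i : product_measurable (Y i) by case: (Yrandom i).
have [theta01 [Delta2 _] _ _] := HA; have /andP[th0 th1] := theta01.
have [r [xi [rd xi0 B2r]]] := B2; have /andP[r1 r_le_d] := rd.
move=> e e0; apply/cvg_measure0P => q q0.
have q4 : 0 < q / 4 by rewrite divr_gt0.
have [M1 fwd] := P1_forward _ q4; have [M2 bwd] := P1_backward _ q4.
pose M := Num.max M1 M2.
pose c0 := theta * (1 - theta) / 2.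
have c00 : 0 < c0 by rewrite divr_gt0 ?mulr_gt0 ?subr_gt0.
(* [K] is the bound that [argmax_localization] imposes on the ratio when
   [b = M g n], [e / 2 <= |k / n - tau|], [c0 <= tau (1 - tau)] and
   [xi / 2 <= |inner Delta v_r|]. *)
pose K := 64 * d%:R * M ^+ 2 / ((e / 2) ^+ 2 * c0 * (xi / 2) ^+ 2).
have e2 : 0 < e / 2 by rewrite divr_gt0.
have xi2 : 0 < xi / 2 by rewrite divr_gt0.
have den0 : 0 < (e / 2) ^+ 2 * c0 * (xi / 2) ^+ 2.
  by apply: mulr_gt0; [apply: mulr_gt0 => //|]; exact: exprn_gt0.
have K0 : 0 <= K.
  by apply: divr_ge0; [apply: mulr_ge0 => //; exact: sqr_ge0|exact: ltW].
pose delta := Num.min (e / 2) c0.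
have delta0 : 0 < delta by rewrite lt_min e2 c00.
have near_B2 := (cvg_measure0P P _).1 (B2r _ xi2) _ q4.
have near_E1 := (cvg_measure0P P _).1 (E1 K) _ q4.
have near_cp := truncn_fraction theta01 delta0.
apply: filter_app fwd; apply: filter_app bwd.
apply: filter_app near_B2; apply: filter_app near_E1.
apply: filterS near_cp => n [cpn tau_theta] E1_n B2_n bwd_n fwd_n.
set cp := Num.truncn _ in cpn tau_theta.
have n2 : (2 <= n)%N by case/andP: cpn; exact: leq_ltn_trans.
have [mk khat_n khat_max] := khat_argmax _ n2.
pose F := max_partial_sum (fun i => Y i%:Z) n.
pose B := max_partial_sum (fun i => Y (- i%:Z + n.+1%:Z)) n.
have mF : measurable_fun setT F by exact: measurable_max_partial_sum.
have mB : measurable_fun setT B by exact: measurable_max_partial_sum.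
have norm_max (Z : nat -> T -> R -> R) (a : R) :
    [set w | a < `|max_partial_sum Z n w|] = [set w | a < max_partial_sum Z n w].
  by apply/seteqP; split => w /=; rewrite ger0_norm ?max_partial_sum_ge0.
rewrite norm_max in fwd_n; rewrite norm_max in bwd_n.
have {}bwd_n : (P [set w | (M2 * g n < B w)%R] <= (q / 4)%:E)%E.
  by rewrite (max_partial_sum_shift Y2 Ystationary (fun i => - i%:Z)).
rewrite [X in (_ <= X%:E)%E](_ : q = q / 4 + q / 4 + q / 4 + q / 4); last by field.
apply: measure_setU4_le fwd_n bwd_n B2_n E1_n.
- exact: measurable_gt.
- exact: measurable_gt.
- apply: measurable_gt; apply: measurableT_comp => //.
  apply: measurable_funB => //; apply: measurableT_comp => //.
  by apply: measurable_inner => //; exact: vhat_on.1.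
- apply: measurable_ratio_le => //.
  + by have [] := lamhat_ev n _ d_gt0.
  + by have [] := lamhat_ev n _ (leqnn 1).
  + move=> w; have [_ /(_ w)[_ ->]] := lamhat_ev n _ d_gt0.
    by apply: (lamhat_anti lamhat_ev); rewrite d_gt0.
- rewrite -[X in measurable X]setTI.
  exact: (mk measurableT [set k | e < `|k%:R / n%:R - theta|]).
move=> w /= far; apply: contrapT => /not_orP[/not_orP[/not_orP[]]].
move=> /negP; rewrite -leNgt => Fle /negP; rewrite -leNgt => Ble.
move=> /negP; rewrite -leNgt => inner_xi /negP; rewrite -ltNge => ratio.
have g0 := g_gt0 n.
(* A ratio above [K >= 0] already forces the estimated eigenvalues to be
   positive, so the maximizing property of [khat] is available. *)
have lamd : 0 < lamhat n d w.
  have [_ /(_ w)[_ l0]] := lamhat_ev n _ d_gt0.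
  rewrite lt_neqAle l0 andbT; apply/negP => /eqP l00.
  by move: ratio; rewrite -l00 mul0r mulr0 ltNge K0.
have lam1 : 0 < lamhat n 1 w.
  by apply: lt_le_trans lamd _; apply: (lamhat_anti lamhat_ev); rewrite d_gt0.
have {}Fle : F w <= M * g n.
  by apply: le_trans Fle _; rewrite ler_pM2r// le_max lexx.
have {}Ble : B w <= M * g n.
  by apply: le_trans Ble _; rewrite ler_pM2r// le_max lexx orbT.
have := argmax_localization HA Y2 vhat_on lamhat_ev (khat_n w) cpn rd lamd Fle Ble (khat_max w lamd _ cpn).
rewrite -/cp; apply/negP; rewrite -ltNge.
move: (khat n w)%:R far => k far.
set tau := cp%:R / n%:R in tau_theta *.
have n0 : 0 < n%:R :> R by rewrite ltr0n (leq_trans _ n2).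
move: tau_theta; rewrite le_min => /andP[tau_e tau_c0].
have eta_ge : e / 2 <= `|k / n%:R - tau|.
  have := ler_distD tau (k / n%:R) theta; lra.
(* [t (1 - t)] is [1]-Lipschitz on [0, 1]. *)
have tau_var : c0 <= tau * (1 - tau).
  have /andP[tau0 tau1] : 0 <= tau <= 1.
    by rewrite divr_ge0//= ler_pdivrMr// mul1r ler_nat ltnW//; case/andP: cpn.
  have -> : tau * (1 - tau) = 2 * c0 + (tau - theta) * (1 - tau - theta).
    by rewrite /c0; field.
  have : `|(tau - theta) * (1 - tau - theta)| <= c0.
    rewrite normrM -[leRHS]mulr1 ler_pM// ler_norml.
    by apply/andP; split; lra.
  by rewrite ler_norml => /andP[+ _]; lra.
have xi_ge : xi / 2 <= `|inner Delta (vhat n r w)|.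
  by move: inner_xi; rewrite ler_norml; lra.
have ratio' : K * g n ^+ 2 * lamhat n 1 w < n%:R * lamhat n d w.
  move: ratio; rewrite mulrA ltr_pdivlMr// [n%:R / _ * _]mulrAC ltr_pdivlMr ?exprn_gt0//.
  by rewrite (mulrAC K (g n ^+ 2)).
have sqr_ge a b : 0 <= a -> a <= `|b| -> a ^+ 2 <= b ^+ 2 :> R.
  by move=> a0 ab; rewrite -[b ^+ 2]real_normK ?num_real// ler_pXn2r// nnegrE.
have eta2 := sqr_ge _ _ (ltW e2) eta_ge.
have xi2' := sqr_ge _ _ (ltW xi2) xi_ge.
have -> : 64 * d%:R * (M * g n) ^+ 2 * lamhat n 1 w =
    (e / 2) ^+ 2 * c0 * (xi / 2) ^+ 2 * (K * g n ^+ 2 * lamhat n 1 w).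
  by rewrite /K; field; rewrite !gt_eqF.
apply: (@lt_le_trans _ _ ((e / 2) ^+ 2 * c0 * (xi / 2) ^+ 2 * (n%:R * lamhat n d w))).
  by rewrite ltr_pM2l.
have -> : `|k / n%:R - tau| ^+ 2 * (n%:R * (tau * (1 - tau))) *
    inner Delta (vhat n r w) ^+ 2 * lamhat n d w =
    `|k / n%:R - tau| ^+ 2 * (tau * (1 - tau)) * inner Delta (vhat n r w) ^+ 2 *
    (n%:R * lamhat n d w) by ring.
rewrite ler_pM2r ?mulr_gt0//.
apply: ler_pM => //; [|exact: sqr_ge0|].
  by apply: mulr_ge0; [exact: sqr_ge0|exact: ltW].
apply: ler_pM => //; [exact: sqr_ge0|exact: ltW|].
by move: eta2; rewrite real_normK ?num_real.
Qed.
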